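(* For all integers $n\geq 0$ and $j\in\{1,2\}$, we have $$\sum_{k=-\infty}^\infty (-1)^kB\left(9n+3j+2-6k(3k+1)\right)\equiv 0\pmod{3}.$$
   Context: For $m\in\mathbb{N}$ and $|q|<1$ let $f_m:=\prod_{n\geq 1}(1-q^{mn})$. $B(n)$ denotes the number of partition triples $\pi=(\pi_1,\pi_2,\pi_3)$ of $n$ (the sum of all parts of $\pi_1,\pi_2,\pi_3$ is $n$; empty partitions are allowed) such that $\pi_1$ and $\pi_2$ each consist of distinct odd parts and $\pi_3$ consists of parts divisible by $4$. Equivalently, $\sum_{n=0}^\infty B(n)q^n=\dfrac{f_2^4}{f_1^2f_4^3}$. Convention: $B(m)=0$ for every negative integer $m$, so the sum over $k\in\mathbb{Z}$ has only finitely many nonzero terms. *)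

(* Defs.v *)
From mathcomp Require Import all_boot all_order all_algebra zify.
From mathcomp Require Import boolp classical_sets cardinality fsbigop.

Set Implicit Arguments.
Unset Strict Implicit.
Unset Printing Implicit Defensive.

Import Order.TTheory GRing.Theory Num.Theory.

Local Open Scope nat_scope.

Definition is_part (s : seq nat) : bool := sorted geq s && all (ltn 0) s.

Definition Btriple (n : nat) (s1 s2 s3 : seq nat) : bool :=
  [&& [&& is_part s1, uniq s1 & all odd s1],
      [&& is_part s2, uniq s2 & all odd s2],
      is_part s3 && all (dvdn 4) s3
    & sumn s1 + sumn s2 + sumn s3 == n].

(* Each component of a partition triple of n has at most n parts, each at most
   n, so it lives in the finite type n.-bseq 'I_n.+1; see [B_enum]. *)
Definition bparts n (s : n.-bseq 'I_n.+1) : seq nat := map val s.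

Definition B (n : nat) : nat :=
  #|[set t : n.-bseq 'I_n.+1 * n.-bseq 'I_n.+1 * n.-bseq 'I_n.+1
    | Btriple n (bparts t.1.1) (bparts t.1.2) (bparts t.2)]|.

Definition Bz (m : int) : int := if m is Posz n then (B n)%:Z else 0%R.

Lemma bparts_inj n : injective (@bparts n).
Proof. by move=> s t /(inj_map val_inj) /val_inj. Qed.

Lemma bparts_onto n (s : seq nat) :
  all (ltn 0) s -> sumn s <= n -> exists u : n.-bseq 'I_n.+1, bparts u = s.
Proof.
move=> s0 sn.
have sz : size [seq inord i : 'I_n.+1 | i <- s] <= n.
  rewrite size_map; apply: leq_trans sn.
  by elim: s s0 => //= x s IH /andP[x0 /IH]; lia.
exists (Bseq sz); rewrite /bparts /= -map_comp -[RHS]map_id.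
apply/eq_in_map => x xs /=; rewrite inordK // ltnS; apply: leq_trans sn.
elim: s xs {s0 sz} => //= y s IH; rewrite inE => /orP[/eqP ->|/IH]; lia.
Qed.

Lemma B_enum n : exists l : seq (seq nat * seq nat * seq nat),
  [/\ uniq l, forall t, (t \in l) = Btriple n t.1.1 t.1.2 t.2 & size l = B n].
Proof.
pose f (t : n.-bseq 'I_n.+1 * n.-bseq 'I_n.+1 * n.-bseq 'I_n.+1) :=
  (bparts t.1.1, bparts t.1.2, bparts t.2).
exists [seq f t | t <- enum [set t | Btriple n (f t).1.1 (f t).1.2 (f t).2]].
split; last by rewrite size_map -cardE.
- rewrite map_inj_uniq ?enum_uniq // => -[[a b] c] [[a' b'] c'].
  by case=> /bparts_inj -> /bparts_inj -> /bparts_inj ->.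
- move=> [[a b] c] /=; apply/mapP/idP => [[t]|tr].
    by rewrite mem_enum inE /f => + [-> -> ->].
  have := tr; rewrite /Btriple /is_part.
  move=> /and4P[/and3P[/andP[_ a0] _ _] /and3P[/andP[_ b0] _ _]].
  move=> /andP[/andP[_ c0] _] /eqP sn.
  have [||u uE] := @bparts_onto n a => //; first lia.
  have [||v vE] := @bparts_onto n b => //; first lia.
  have [||w wE] := @bparts_onto n c => //; first lia.
  by exists (u, v, w); rewrite ?mem_enum ?inE /f /= uE vE wE.
Qed.

(* [\sum_(k \in A) F k] is 0 by convention on an infinite support; this does
   not happen here. *)
Lemma finite_Bterm (N : nat) : finite_set [set k : int |
  (-1) ^ k * Bz (N%:Z - 6 * k * (3 * k + 1)) <> 0]%R%classic.
Proof.
apply: (@sub_finite_set _ _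
  [set` [seq i%:Z | i <- iota 0 N.+1] ++ [seq - i%:Z | i <- iota 0 N.+1]]%R%classic);
  last exact: finite_seq.
move=> k kN; rewrite /mkset mem_cat.
have kb : `|k| <= N.
  apply/negP => /negP lt; apply: kN.
  suff : (N%:Z - 6 * k * (3 * k + 1) < 0)%R.
    by case: (_ - _)%R => // m _; rewrite mulr0.
  nia.
case: (lerP 0 k) => k0; apply/orP; [left|right]; apply/mapP; exists `|k|;
  rewrite ?mem_iota; lia.
Qed.

(* Main.v *)
Require Import Defs.
From mathcomp Require Import all_boot all_order all_algebra ring zify.
From mathcomp Require Import classical_sets fsbigop.

Import Order.TTheory GRing.Theory Num.Theory.
Local Open Scope classical_set_scope.
Local Open Scope ring_scope.

(** Write [f_m] for the product of the [1 - q^(m i)], [i >= 1].  The exponent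
    [6k(3k+1)] is 12 times the generalized pentagonal number [k(3k+1)/2], so by
    Euler's pentagonal number theorem the alternating sum is the coefficient of
    [q^N], [N = 9n + 3j + 2], in [f_12 * sum_n B(n) q^n].

    Modulo 3 one has [f_12 = f_4^3].  Splitting a triple into its three
    components gives [sum_n B(n) q^n = O^2 / f_4], where [O] is the product of the
    [1 + q^(2i+1)].  Hence the product above is congruent to [(O f_4)^2].  By the
    Jacobi triple product, [O f_4] is Gauss's series [sum_k q^(k(2k+1))], the sum
    of [q^t] over the triangular numbers [t].  So modulo 3 the alternating sum
    counts the ways of writing [N] as [k(2k+1) + l(2l+1)], that is, [8N + 2] as
    [(4k+1)^2 + (4l+1)^2].  There is no such way: [8N + 2 = 6(12n + 4j + 3)] is
    divisible by 3 but, as 3 does not divide [j], not by 9, whereas a sum of two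
    squares divisible by 3 is divisible by 9.

    All series are replaced by polynomials over ['F_3] modulo ['X^N.+1]
    ([eqmodX]).  Both theta series come from a single truncated Jacobi triple
    product, [jacobi_triple_eqmodX], itself a consequence of the exact finite
    identity [finite_jacobi_triple]; the product formula for the generating
    function of [B] is [B_gf_eqmodX], and everything is put together in
    [pentagonal_B_eqmodX]. *)

(** * Gaussian binomials and the finite Jacobi triple product *)

Definition qpoch {R : pzRingType} (Q : R) (n : nat) : R :=
  \prod_(i < n) (1 - Q ^+ i.+1).

Fixpoint qbin {R : pzRingType} (Q : R) (m j : nat) : R :=
  match m, j with
  | _, 0%N => 1
  | 0%N, _.+1 => 0
  | m'.+1, j'.+1 => qbin Q m' j'.+1 + Q ^+ (m' - j') * qbin Q m' j'
  end.

(** The general term [x^k (xy)^(k(k-1)/2)] of the triple product series, with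
    [x^-1 (xy)] replaced by [y] so that it makes sense for negative [k] without
    inverting [x]. *)
Definition theta_term {R : pzRingType} (x y : R) (k : int) : R :=
  match k with
  | Posz m => x ^+ m * (x * y) ^+ 'C(m, 2)
  | Negz m => y ^+ m.+1 * (x * y) ^+ 'C(m.+1, 2)
  end.

Lemma qbinn0 {R : pzRingType} (Q : R) m : qbin Q m 0 = 1.
Proof. by case: m. Qed.

Lemma qbin_small {R : pzRingType} (Q : R) m j : (m < j)%N -> qbin Q m j = 0.
Proof.
elim: m j => [|m IH] [|j] //= mj.
by rewrite !IH ?mulr0 ?addr0 //; lia.
Qed.

Lemma qpochS {R : pzRingType} (Q : R) n :
  qpoch Q n.+1 = qpoch Q n * (1 - Q ^+ n.+1).
Proof. by rewrite /qpoch big_ord_recr. Qed.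

(** The two terms of the recurrence contribute [1 - Q^(m-j)] and
    [Q^(m-j) (1 - Q^(j+1))] times [qpoch Q m], and these factors add up to
    [1 - Q^(m+1)]. *)
Lemma qbin_qpoch {R : comPzRingType} (Q : R) m j : (j <= m)%N ->
  qpoch Q j * qpoch Q (m - j) * qbin Q m j = qpoch Q m.
Proof.
have p0 : qpoch Q 0 = 1 by rewrite /qpoch big_ord0.
elim: m j => [|m IH] [|j] jm; rewrite ?qbinn0 ?subn0 ?p0 ?mul1r ?mulr1 //=.
rewrite subSS; have [jm'|mj] := ltnP j m.
  have := IH j (ltnW jm'); have := IH j.+1 jm'.
  have [d dE] : exists d, (m - j)%N = d.+1 by exists (m - j.+1)%N; lia.
  rewrite subnS dE /= (qpochS Q j) (qpochS Q m) (qpochS Q d).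
  have -> : Q ^+ m.+1 = Q ^+ d.+1 * Q ^+ j.+1.
    by rewrite -exprD; congr (_ ^+ _); lia.
  move=> E1 E2.
  transitivity (qpoch Q m * (1 - Q ^+ d.+1) +
                qpoch Q m * (Q ^+ d.+1 * (1 - Q ^+ j.+1))); last by ring.
  by rewrite -{1}E1 -E2; ring.
have -> : j = m by lia.
rewrite (@qbin_small _ Q m m.+1) // subnn add0r expr0 mul1r p0 mulr1.
have := IH m (leqnn m); rewrite subnn p0 mulr1 qpochS => {2}<-.
by ring.
Qed.

(** The form homogeneous in [u] and [v] lets the triple product be obtained with
    [u = Q^n] and no negative power of [Q]. *)
Lemma qbinomial_thm {R : comPzRingType} (Q u v : R) m :
  \prod_(i < m) (u + v * Q ^+ i) =
  \sum_(j < m.+1) qbin Q m j * Q ^+ 'C(j, 2) * v ^+ j * u ^+ (m - j).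
Proof.
elim: m => [|m IH].
  by rewrite big_ord0 big_ord1 /= bin0n !expr0 !mulr1.
rewrite big_ord_recr /= IH mulrDr [RHS]big_ord_recl /= subn0.
rewrite bin0n !expr0 !mulr1 mul1r.
under [in RHS]eq_bigr => j _ do
  rewrite /bump add1n add0n subSS /= !mulrDl.
rewrite big_split /= addrA; congr (_ + _).
  rewrite big_ord_recl [in RHS]big_ord_recr /= (@qbin_small _ Q m m.+1) //.
  rewrite !mul0r addr0 mulrDl qbinn0 bin0n !expr0 subn0 !mulr1 mul1r -exprSr.
  congr (_ + _).
  rewrite mulr_suml; apply: eq_bigr => j _.
  rewrite /bump add1n -[LHS]mulrA -exprSr; congr (_ * _ ^+ _).
  by have := ltn_ord j; lia.
rewrite mulr_suml; apply: eq_bigr => j _.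
have -> : 'C(j.+1, 2) = ('C(j, 2) + j)%N by rewrite binS bin1.
have -> : Q ^+ m = Q ^+ (m - j) * Q ^+ j.
  by rewrite -exprD; congr (_ ^+ _); have := ltn_ord j; lia.
by rewrite exprD exprS; ring.
Qed.

Lemma bin2D m n : 'C(m + n, 2) = ('C(m, 2) + 'C(n, 2) + m * n)%N.
Proof.
by elim: n => [|n IH]; rewrite ?addn0 ?addnS ?binS ?bin1 ?IH ?bin0n; lia.
Qed.

(** Cauchy's proof: up to the factor [c], the product is the left-hand side of the
    homogeneous q-binomial theorem of order [2n] with [u = Q^n], [v = x], whose
    lower half of factors [Q^n + x Q^i] equals [Q^i x (1 + y Q^(n-1-i))].  The
    integral domain serves to cancel [c]. *)
Lemma finite_jacobi_triple {R : idomainType} (x y : R) n :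
  x * y != 0 ->
  \prod_(i < n) ((1 + x * (x * y) ^+ i) * (1 + y * (x * y) ^+ i)) =
  \sum_(j < n.*2.+1) qbin (x * y) n.*2 j * theta_term x y (j%:Z - n%:Z).
Proof.
move=> xy0; set Q := x * y.
have x0 : x != 0 by apply: contraNneq xy0 => ->; rewrite mul0r.
pose c := Q ^+ ('C(n, 2) + n * n) * x ^+ n.
have c0 : c != 0 by rewrite mulf_neq0 // expf_neq0.
apply: (mulfI c0).
have -> : c * \prod_(i < n) ((1 + x * Q ^+ i) * (1 + y * Q ^+ i)) =
          \prod_(i < n.*2) (Q ^+ n + x * Q ^+ i).
  (* The y-factors come out in the reverse order. *)
  rewrite -addnn big_split_ord /=.
  rewrite [X in _ = X * _](reindex_inj rev_ord_inj) /= -big_split /=.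
  have -> : c = \prod_(i < n) (Q ^+ (n - i.+1) * Q ^+ n * x).
    rewrite /c exprD exprM !big_split /= !prodr_const !card_ord.
    congr (_ * _ * _).
    rewrite prodrXr; congr (_ ^+ _).
    rewrite (reindex_inj rev_ord_inj) -bin2_sum big_mkord.
    by apply: eq_bigr => i _ /=; have := ltn_ord i; lia.
  rewrite -big_split /=; apply: eq_bigr => i _.
  have -> : Q ^+ (n + i) = Q ^+ n * Q ^+ i by rewrite exprD.
  have -> : Q ^+ n = Q ^+ (n - i.+1) * (Q * Q ^+ i).
    by rewrite -exprS -exprD; congr (_ ^+ _); have := ltn_ord i; lia.
  by rewrite {4 6 8 10}/Q; ring.
rewrite qbinomial_thm mulr_sumr; apply: eq_bigr => j _.
rewrite mulrCA -!mulrA; congr (_ * _); apply: esym.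
have [nj|jn] := leqP n j.
  have [k jE] : exists k, nat_of_ord j = (n + k)%N by exists (j - n)%N; lia.
  have -> : j%:Z - n%:Z = k by lia.
  have -> : (n.*2 - j = n - k)%N by lia.
  have kn : (k <= n)%N by have := ltn_ord j; lia.
  rewrite jE bin2D exprD -exprM /theta_term -/Q /c.
  transitivity (x ^+ n * x ^+ k * Q ^+ ('C(n, 2) + n * n + 'C(k, 2))).
    by rewrite !exprD; ring.
  have -> : ('C(n, 2) + n * n + 'C(k, 2) =
             'C(n, 2) + 'C(k, 2) + n * k + n * (n - k))%N by nia.
  by rewrite !exprD; ring.
have [k nE] : exists k, n = (j + k.+1)%N by exists (n - j.+1)%N; lia.
have -> : j%:Z - n%:Z = Negz k by lia.
have -> : (n.*2 - j = j + k.+1 + k.+1)%N by lia.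
rewrite /theta_term -/Q /c -exprM.
transitivity (x ^+ j * (x ^+ k.+1 * y ^+ k.+1) *
              Q ^+ ('C(n, 2) + n * n + 'C(k.+1, 2))).
  have -> : x ^+ n = x ^+ j * x ^+ k.+1 by rewrite -exprD -nE.
  by rewrite !exprD; ring.
rewrite -exprMn -/Q -mulrA -exprD mulrC [x ^+ j * _]mulrC mulrA -exprD.
congr (Q ^+ _ * _).
rewrite [in 'C(n, 2)]nE bin2D.
have := mul_bin_diag k.+1 1; rewrite /= bin1.
nia.
Qed.

(** * Congruence of polynomials modulo a power of the indeterminate *)

Definition eqmodX {F : fieldType} (M : nat) (p q : {poly F}) : bool :=
  'X^M %| p - q.

Lemma eqmodX_refl {F : fieldType} M (p : {poly F}) : eqmodX M p p.
Proof. by rewrite /eqmodX subrr dvdp0. Qed.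

Lemma eqmodX_sym {F : fieldType} M (p q : {poly F}) :
  eqmodX M p q -> eqmodX M q p.
Proof. by rewrite /eqmodX -opprB dvdpNr. Qed.

Lemma eqmodX_trans {F : fieldType} M (p q r : {poly F}) :
  eqmodX M p q -> eqmodX M q r -> eqmodX M p r.
Proof. by rewrite /eqmodX => pq qr; rewrite -(subrKA q) dvdp_add. Qed.

Lemma eqmodX_mul {F : fieldType} M (p p' q q' : {poly F}) :
  eqmodX M p p' -> eqmodX M q q' -> eqmodX M (p * q) (p' * q').
Proof.
rewrite /eqmodX => pp qq.
have -> : p * q - p' * q' = (p - p') * q + p' * (q - q') by ring.
by rewrite dvdp_add ?(dvdp_mulr _ pp) ?(dvdp_mull _ qq).
Qed.

Lemma eqmodX_sum {F : fieldType} M (I : Type) (r : seq I)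
    (f g : I -> {poly F}) :
  (forall i, eqmodX M (f i) (g i)) ->
  eqmodX M (\sum_(i <- r) f i) (\sum_(i <- r) g i).
Proof.
move=> fg; elim: r => [|i r IH]; first by rewrite !big_nil eqmodX_refl.
by rewrite !big_cons /eqmodX opprD addrACA dvdp_add //; apply: fg.
Qed.

Lemma eqmodX_prod {F : fieldType} M (I : Type) (r : seq I)
    (f g : I -> {poly F}) :
  (forall i, eqmodX M (f i) (g i)) ->
  eqmodX M (\prod_(i <- r) f i) (\prod_(i <- r) g i).
Proof.
move=> fg; elim: r => [|i r IH]; first by rewrite !big_nil eqmodX_refl.
by rewrite !big_cons eqmodX_mul.
Qed.

Lemma eqmodX_leq {F : fieldType} M N (p q : {poly F}) :
  (M <= N)%N -> eqmodX N p q -> eqmodX M p q.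
Proof. by move=> MN; apply: dvdp_trans; rewrite dvdp_exp2l. Qed.

Lemma eqmodX_coef {F : fieldType} M (p q : {poly F}) i :
  (i < M)%N -> eqmodX M p q -> p`_i = q`_i.
Proof.
move=> iM /dvdpP[r pq]; apply/eqP; rewrite -subr_eq0 -coefB pq.
by rewrite coefMXn iM.
Qed.

Lemma coef_eqmodX {F : fieldType} M (p q : {poly F}) :
  (forall i, (i < M)%N -> p`_i = q`_i) -> eqmodX M p q.
Proof.
move=> pq; apply/dvdpP; exists (drop_poly M (p - q)).
rewrite -[LHS](poly_take_drop M) [X in X + _](_ : _ = 0) ?add0r //.
apply/polyP => i; rewrite coef_take_poly coef0 coefB.
by case: ltnP => // iM; rewrite pq ?subrr.
Qed.

(** A polynomial with nonzero constant term is prime to ['X^M]. *)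
Lemma eqmodX_cancel {F : fieldType} M (u p q : {poly F}) :
  u`_0 != 0 -> eqmodX M (u * p) (u * q) -> eqmodX M p q.
Proof.
move=> u0; rewrite /eqmodX -mulrBr Gauss_dvdpr // coprimep_expl //.
by rewrite coprimep_sym -['X]subr0 -polyC0 coprimep_XsubC rootE horner_coef0.
Qed.

(** * The truncated Jacobi triple product *)

Lemma qpochXn_eqmodX {F : fieldType} d m n : (m <= n)%N ->
  eqmodX (d * m.+1) (qpoch ('X^d : {poly F}) n) (qpoch 'X^d m).
Proof.
elim: n => [|n IH]; first by rewrite leqn0 => /eqP->; apply: eqmodX_refl.
rewrite leq_eqVlt => /orP[/eqP->|mn]; first exact: eqmodX_refl.
rewrite qpochS -[X in eqmodX _ _ X]mulr1; apply: eqmodX_mul; first exact: IH.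
by rewrite /eqmodX addrAC subrr add0r dvdpNr -exprM dvdp_exp2l //; nia.
Qed.

Lemma qpochXn_coef0 {F : fieldType} d n :
  (qpoch ('X^(d.+1) : {poly F}) n)`_0 = 1.
Proof.
rewrite -horner_coef0 /qpoch horner_prod big1 // => i _.
by rewrite !hornerE expr0n /= expr0n /= subr0.
Qed.

(** As [n] grows, [qpoch Q n] times the central Gaussian binomials tends to 1.  With
    [r] the distance from [j] to the nearer of 0 and [2n], all the q-Pochhammer
    symbols in [qbin_qpoch] agree with [qpoch Q r] modulo [Q^(r+1)]. *)
Lemma qbinXn_eqmodX {F : fieldType} d n j : (j <= n.*2)%N ->
  eqmodX (d.+1 * (minn j (n.*2 - j)).+1)
    (qpoch ('X^(d.+1) : {poly F}) n * qbin 'X^(d.+1) n.*2 j) 1.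
Proof.
move=> jn; set r := minn _ _; set Q := 'X^(d.+1); set M := (_ * _)%N.
have Pr m : (r <= m)%N -> eqmodX M (qpoch Q m) (qpoch Q r).
  exact: qpochXn_eqmodX.
have rn : (r <= n)%N by rewrite /r; lia.
apply: (@eqmodX_trans _ _ _ (qpoch Q r * qbin Q n.*2 j)).
  by rewrite eqmodX_mul ?eqmodX_refl ?Pr.
apply: (@eqmodX_cancel _ _ (qpoch Q r)).
  by rewrite qpochXn_coef0 oner_neq0.
rewrite mulr1; apply: (@eqmodX_trans _ _ _ (qpoch Q n.*2)).
  2: by apply: Pr; lia.
rewrite -(qbin_qpoch Q _ _ jn) mulrA; apply: eqmodX_sym.
by rewrite !eqmodX_mul ?eqmodX_refl ?Pr // /r; lia.
Qed.

(** The exponent [a k(k+1)/2 + b k(k-1)/2], as a natural number. *)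
Definition theta_exp (a b : nat) (k : int) : nat :=
  match k with
  | Posz m => a * m + (a + b) * 'C(m, 2)
  | Negz m => b * m.+1 + (a + b) * 'C(m.+1, 2)
  end.

Lemma theta_termXn {F : fieldType} (s : F) (a b : nat) k : s * s = 1 ->
  theta_term (s *: 'X^a) (s *: 'X^b) k =
  s ^+ `|k| *: 'X^(theta_exp a b k) :> {poly F}.
Proof.
move=> ss.
have Q : (s *: 'X^a) * (s *: 'X^b) = 'X^(a + b) :> {poly F}.
  by rewrite -scalerAl -scalerAr scalerA ss scale1r exprD.
by case: k => m; rewrite /theta_term Q exprZn -scalerAl -!exprM -exprD.
Qed.

(** The case [x = s q^a], [y = s q^b] of the triple product, where [s^2 = 1].  The
    truncation order [n + 1] suffices: the [j]-th term is off by a multiple of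
    [q^((a+b)(r+1))], [r] being the distance from [j] to the nearer of 0 and [2n],
    while its exponent is at least [|j - n|], and [r + |j - n| = n]. *)
Lemma jacobi_triple_eqmodX {F : fieldType} (s : F) (a b n : nat) :
  s * s = 1 -> (0 < a)%N -> (0 < b)%N ->
  eqmodX n.+1
    (qpoch 'X^(a + b) n *
     \prod_(i < n) ((1 + s *: 'X^(a + (a + b) * i)) *
                    (1 + s *: 'X^(b + (a + b) * i))))
    (\sum_(j < n.*2.+1)
       s ^+ `|j%:Z - n%:Z| *: 'X^(theta_exp a b (j%:Z - n%:Z))).
Proof.
move=> ss a0 b0.
have Q : (s *: 'X^a) * (s *: 'X^b) = 'X^(a + b) :> {poly F}.
  by rewrite -scalerAl -scalerAr scalerA ss scale1r exprD.
have := @finite_jacobi_triple _ (s *: 'X^a : {poly F}) (s *: 'X^b) n.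
rewrite Q monic_neq0 ?monicXn // => /(_ isT) E.
rewrite [X in _ * X](_ : _ = \sum_(j < n.*2.+1) qbin 'X^(a + b) n.*2 j *
    (s ^+ `|j%:Z - n%:Z| *: 'X^(theta_exp a b (j%:Z - n%:Z)))); last first.
  under [RHS]eq_bigr => j _ do rewrite -theta_termXn //.
  rewrite -E; apply: eq_bigr => i _.
  by rewrite -!scalerAl -!exprM -!exprD.
rewrite mulr_sumr; apply: eqmodX_sum => j; rewrite mulrA.
rewrite /eqmodX -[X in _ - X]mul1r -mulrBl -scalerAr.
have jn : (j <= n.*2)%N by have := ltn_ord j; lia.
have [d dE] : exists d, (a + b = d.+1)%N by exists (a + b).-1; lia.
have := @qbinXn_eqmodX F d n j jn; rewrite -dE => /dvdpP[r ->].
rewrite -mulrA -exprD -mul_polyC !dvdp_mull // dvdp_exp2l //.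
set k := j%:Z - n%:Z.
have kE : (`|k| <= theta_exp a b k)%N by case: k => m /=; nia.
by have := leq_pmull (minn j (n.*2 - j)).+1 (ltn_addr b a0); lia.
Qed.

(** * Enumerating partitions by multiplicities *)

(** The partitions with parts among [f 0], ..., [f (K-1)], each repeated fewer
    than [m] times.  Taking [m = 2] gives distinct parts; a large [m] puts no
    constraint on partitions of small numbers. *)
Fixpoint bounded_parts (f : nat -> nat) (m K : nat) : seq (seq nat) :=
  if K is K'.+1
  then [seq nseq i (f K') ++ s | i <- iota 0 m, s <- bounded_parts f m K']
  else [:: [::]].

Lemma mem_bounded_parts f m K s : (0 < m)%N -> {homo f : i j / (i < j)%N} ->
  (s \in bounded_parts f m K) =
  [&& sorted geq s, all (fun x => x \in [seq f i | i <- iota 0 K]) s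
    & all (fun p => count_mem p s < m)%N s].
Proof.
move=> m0 fS; elim: K s => [|K IH] s.
  by case: s => [|x s]; rewrite // inE /= andbF.
have geq_trans : transitive geq by move=> x y z; rewrite /geq /=; lia.
have geq_anti : antisymmetric geq by move=> x y; rewrite /geq /=; lia.
have fK u x : all (fun x => x \in [seq f i | i <- iota 0 K]) u ->
    x \in u -> (x < f K)%N.
  move=> /allP uf /uf /mapP[i]; rewrite mem_iota => /andP[_ iK] ->.
  exact: fS.
have fKn u : all (fun x => x \in [seq f i | i <- iota 0 K]) u -> f K \notin u.
  by move=> uf; apply/negP => /(fK _ _ uf); rewrite ltnn.
have iotaS : iota 0 K.+1 = rcons (iota 0 K) K by rewrite -addn1 iotaD cats1.
rewrite [bounded_parts _ _ _]/= iotaS map_rcons; apply/allpairsP/and3P.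
  move=> [[i u] /= [im uK ->]]; move: uK; rewrite IH => /and3P[su uf uc].
  have iE : count_mem (f K) (nseq i (f K) ++ u) = i.
    rewrite count_cat count_nseq /= eqxx mul1n.
    by rewrite (count_memPn (fKn _ uf)) addn0.
  split.
  - rewrite sorted_pairwise // pairwise_cat -!sorted_pairwise // su andbT.
    apply/andP; split.
      apply/allrelP => x y; rewrite mem_nseq => /andP[_ /eqP->] /(fK _ _ uf).
      exact: ltnW.
    by elim: i {im iE} => //= -[|i] //= ->; rewrite /geq /= leqnn.
  - rewrite all_cat; apply/andP; split.
      by rewrite all_nseq /= mem_rcons inE eqxx orbT.
    apply: sub_all uf => x; rewrite mem_rcons inE => ->.
    by rewrite orbT.
  - apply/allP => x; rewrite mem_cat mem_nseq => /orP[/andP[_ /eqP->]|xu].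
      by rewrite iE; move: im; rewrite mem_iota.
    have xK := fK _ _ uf xu.
    rewrite count_cat count_nseq /= gtn_eqF // mul0n add0n.
    by move/allP: uc => /(_ _ xu).
move=> [ss sf sc].
pose u := [seq x <- s | x != f K].
have sE : s = nseq (count_mem (f K) s) (f K) ++ u.
  have nE : [seq x <- s | pred1 (f K) x] = nseq (count_mem (f K) s) (f K).
    by rewrite -size_filter; apply/all_pred1P; rewrite filter_all.
  apply: (sorted_eq geq_trans geq_anti) => //; last first.
    by rewrite perm_sym -nE; apply/permPl/perm_filterC.
  rewrite sorted_pairwise // pairwise_cat -!sorted_pairwise //.
  rewrite sorted_filter // -nE sorted_filter // !andbT.
  apply/allrelP => x y; rewrite !mem_filter => /andP[/eqP-> _] /andP[_ ys].
  move/allP: sf => /(_ _ ys); rewrite mem_rcons inE => /predU1P[-> //|].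
    exact: leqnn.
  by move=> /mapP[i]; rewrite mem_iota => /andP[_ iK] ->; apply/ltnW/fS.
exists (count_mem (f K) s, u); split => //=.
  rewrite mem_iota /=; have [sK|/count_memPn ->] := boolP (f K \in s).
    by move/allP: sc => /(_ _ sK).
  exact: m0.
rewrite IH; apply/and3P; split.
- exact: sorted_filter.
- apply/allP => x; rewrite mem_filter => /andP[xK xs].
  move/allP: sf => /(_ _ xs); rewrite mem_rcons inE.
  by rewrite (negPf xK).
- apply/allP => x; rewrite mem_filter => /andP[xK xs].
  rewrite count_filter; move/allP: sc => /(_ _ xs); apply: leq_ltn_trans.
  by apply: sub_count => y /andP[].
Qed.

Lemma bounded_parts_uniq f m K : (0 < m)%N -> {homo f : i j / (i < j)%N} ->
  uniq (bounded_parts f m K).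
Proof.
move=> m0 fS; elim: K => [//|K IH] /=.
apply: allpairs_uniq; rewrite ?iota_uniq //.
move=> [i u] [j v] /allpairsP[[i' u'] /= [_ uP [-> ->]]].
move=> /allpairsP[[j' v'] /= [_ vP [-> ->]]] E.
have fKn w : w \in bounded_parts f m K -> count_mem (f K) w = 0%N.
  rewrite mem_bounded_parts // => /and3P[_ /allP wf _]; apply/count_memPn.
  apply/negP => /wf /mapP[l]; rewrite mem_iota => /andP[_ lK] /eqP.
  by rewrite gtn_eqF ?fS.
have ij : i' = j'.
  have := congr1 (count_mem (f K)) E.
  by rewrite !count_cat !count_nseq /= eqxx !mul1n !fKn // !addn0.
by move: E; rewrite ij => /eqP; rewrite eqseq_cat // eqxx /= => /eqP->.
Qed.

(** A partition is determined by the independent choices of the multiplicities of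
    its parts. *)
Lemma bounded_parts_gf {R : comNzRingType} f m K :
  \sum_(s <- bounded_parts f m K) 'X^(sumn s) =
  \prod_(i < K) \sum_(j < m) 'X^(f i * j) :> {poly R}.
Proof.
elim: K => [|K IH]; first by rewrite big_ord0 big_seq1.
rewrite big_ord_recr /= -IH big_allpairs_dep /= mulrC.
rewrite -(big_mkord xpredT (fun j => 'X^(f K * j))) /index_iota subn0.
rewrite mulr_suml; apply: eq_bigr => i _.
rewrite mulr_sumr; apply: eq_bigr => s _.
by rewrite sumn_cat sumn_nseq exprD.
Qed.

Lemma mem_leq_sumn (s : seq nat) x : x \in s -> (x <= sumn s)%N.
Proof. by elim: s => //= y s IH; rewrite inE => /orP[/eqP->|/IH]; lia. Qed.

Lemma size_leq_sumn (s : seq nat) : all (ltn 0) s -> (size s <= sumn s)%N.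
Proof. by elim: s => //= y s IH /andP[y0 /IH]; lia. Qed.

(** Odd parts of a partition of a number at most [K] are among the first [K] odd
    numbers. *)
Lemma mem_odd_parts K s : (sumn s <= K)%N ->
  (s \in bounded_parts (fun i => i.*2.+1) 2 K) =
  [&& is_part s, uniq s & all odd s].
Proof.
move=> sK; rewrite mem_bounded_parts; [|lia|by move=> i j; lia].
rewrite /is_part -!andbA; congr (_ && _).
apply/andP/and3P.
  move=> [/allP sf /allP sc].
  have sE x : x \in s -> odd x.
    by move=> /sf /mapP[i _ ->] /=; rewrite odd_double.
  split.
  - by apply/allP => x /sE /=; lia.
  - apply: count_mem_uniq => x; have [xs|/count_memPn //] := boolP (x \in s).
    by have := sc _ xs; move: xs; rewrite -has_pred1 has_count /=; lia.
  - exact/allP.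
move=> [/allP s0 us /allP so]; split.
  apply/allP => x xs; apply/mapP; exists x./2.
    by rewrite mem_iota; have := mem_leq_sumn _ _ xs; have := so _ xs; lia.
  by have := so _ xs; lia.
by apply/allP => x xs; rewrite count_uniq_mem // xs.
Qed.

Lemma mem_mult4_parts m K s : (sumn s <= K)%N -> (sumn s < m)%N ->
  (s \in bounded_parts (fun i => 4 * i.+1)%N m K) =
  is_part s && all (dvdn 4) s.
Proof.
move=> sK sm; rewrite mem_bounded_parts; [|lia|by move=> i j; lia].
rewrite /is_part -!andbA; congr (_ && _).
apply/andP/andP.
  move=> [/allP sf _].
  by split; apply/allP => x /sf /mapP[i _ ->]; rewrite ?dvdn_mulr /=; lia.
move=> [s0 /allP s4]; split.
  apply/allP => x xs; have : (0 < x)%N := allP s0 _ xs.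
  have := mem_leq_sumn _ _ xs.
  have /dvdnP[i ->] := s4 _ xs; move=> ix i0; apply/mapP; exists i.-1.
    by rewrite mem_iota; lia.
  by lia.
apply/allP => x xs; apply: leq_ltn_trans sm.
by apply: leq_trans (size_leq_sumn _ s0); apply: count_size.
Qed.

(** A finite list independent of the number to be partitioned, so that a single
    polynomial carries many values of [B]. *)
Definition B_triples m K : seq (seq nat * seq nat * seq nat) :=
  let A := bounded_parts (fun i => i.*2.+1) 2 K in
  let C := bounded_parts (fun i => 4 * i.+1)%N m K in
  [seq (x, u) | x <- [seq (s, t) | s <- A, t <- A], u <- C].

Lemma B_count m K n : (n <= K)%N -> (n < m)%N ->
  B n = count (fun t => sumn t.1.1 + sumn t.1.2 + sumn t.2 == n)%N
              (B_triples m K).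
Proof.
move=> nK nm; have [l [ul lP <-]] := B_enum n.
rewrite -size_filter; apply: perm_size; apply: uniq_perm => //.
  apply: filter_uniq; apply: allpairs_uniq.
  - apply: allpairs_uniq; first by apply: bounded_parts_uniq => [|i j]; lia.
    + by apply: bounded_parts_uniq => [|i j]; lia.
    + by move=> [? ?] [? ?] _ _ [-> ->].
  - by apply: bounded_parts_uniq => [|i j]; lia.
  - by move=> [? ?] [? ?] _ _ [-> ->].
move=> [[s t] u]; rewrite lP mem_filter /Btriple /= andbC.
have [/eqP E|_] := boolP (_ == n); last by rewrite !andbF.
rewrite !andbT andTb.
have -> : ((s, t, u) \in B_triples m K) =
  [&& s \in bounded_parts (fun i => i.*2.+1) 2 K,
      t \in bounded_parts (fun i => i.*2.+1) 2 K
    & u \in bounded_parts (fun i => 4 * i.+1)%N m K].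
  apply/allpairsP/and3P.
    by move=> [[x v] /= [/allpairsP[[s' t'] /= [sA tA ->]] vC [-> -> ->]]].
  move=> [sA tA uC]; exists ((s, t), u); split => //.
  by apply/allpairsP; exists (s, t).
by rewrite !mem_odd_parts ?mem_mult4_parts //; lia.
Qed.

(** * The generating function of B *)

Lemma mul_geometric_series {R : comPzRingType} (x : R) m :
  (1 - x) * \sum_(j < m) x ^+ j = 1 - x ^+ m.
Proof. by rewrite -[1 - x]opprB mulNr -subrX1 opprB. Qed.

(** The truncated form of [f_4 * sum_n B(n) q^n = O^2]: the geometric series of
    the multiples of 4 are cancelled by the factors of [f_4], up to powers of the
    indeterminate beyond the truncation. *)
Lemma B_gf_eqmodX {F : fieldType} M K : (M <= K.+1)%N ->
  eqmodX M (qpoch 'X^4 K * \poly_(i < M) (B i)%:R)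
    ((\prod_(i < K) (1 + 'X^(i.*2.+1))) ^+ 2 : {poly F}).
Proof.
move=> MK.
pose A := bounded_parts (fun i => i.*2.+1) 2 K.
pose C := bounded_parts (fun i => 4 * i.+1)%N M K.
have AE : \sum_(s <- A) 'X^(sumn s) =
          \prod_(i < K) (1 + 'X^(i.*2.+1)) :> {poly F}.
  rewrite bounded_parts_gf; apply: eq_bigr => i _.
  by rewrite big_ord_recl big_ord1 /= muln0 muln1 expr0.
have CE : eqmodX M (qpoch 'X^4 K * \sum_(u <- C) 'X^(sumn u)) (1 : {poly F}).
  rewrite bounded_parts_gf /qpoch -big_split /=.
  rewrite [X in eqmodX _ _ X](_ : 1 = \prod_(i < K) 1); last first.
    by rewrite big1_eq.
  apply: eqmodX_prod => i.
  under eq_bigr => j _ do rewrite !exprM.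
  rewrite mul_geometric_series /eqmodX addrAC subrr add0r dvdpNr -!exprM.
  by rewrite dvdp_exp2l //; nia.
have BE : eqmodX M (\poly_(i < M) (B i)%:R : {poly F})
    ((\sum_(s <- A) 'X^(sumn s)) ^+ 2 * \sum_(u <- C) 'X^(sumn u)).
  apply: coef_eqmodX => i iM; rewrite coef_poly iM.
  rewrite (B_count M K); try lia.
  transitivity (\sum_(t <- B_triples M K)
      'X^(sumn t.1.1 + sumn t.1.2 + sumn t.2) : {poly F})`_i.
    rewrite coef_sum -sum1_count big_mkcond natr_sum; apply: eq_bigr => t _.
    by rewrite coefXn eq_sym; case: eqP.
  congr ((_ : {poly F})`_i); rewrite big_allpairs_dep expr2.
  rewrite big_distrlr /= mulr_suml.
  rewrite big_allpairs_dep /=; apply: eq_bigr => s _.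
  rewrite mulr_suml; apply: eq_bigr => t _.
  by rewrite mulr_sumr; apply: eq_bigr => u _; rewrite !exprD.
apply: eqmodX_trans (eqmodX_mul _ _ _ _ _ (eqmodX_refl _ _) BE) _.
by rewrite AE mulrCA -[X in eqmodX _ _ X]mulr1 eqmodX_mul ?eqmodX_refl.
Qed.

(** * The two theta series *)

Lemma theta_expE a b k :
  (2 * theta_exp a b k)%:Z = (a + b)%:Z * k ^+ 2 + (a%:Z - b%:Z) * k.
Proof.
case: k => m /=; first by have := mul_bin_diag m 1; rewrite bin1; nia.
by have := mul_bin_diag m.+1 1; rewrite bin1 /=; nia.
Qed.

(** [theta_exp 3 1 k] is [k(2k+1)].  Modulo 3 it is 0, 0, 1 for [k = 0, 1, -1], so
    a sum of two of them is 2 modulo 3 only for [k] and [l] both [-1] modulo 3;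
    but [k(2k+1)] is then 1 modulo 9, and the sum is 2 modulo 9. *)
Lemma theta31_sum_neq n j k l : j = 1%N \/ j = 2%N ->
  (theta_exp 3 1 k + theta_exp 3 1 l)%N != (9 * n + 3 * j + 2)%N.
Proof.
move=> hj; apply/eqP => E.
move: (theta_expE 3 1 k) (theta_expE 3 1 l) E; rewrite !expr2.
move: (theta_exp 3 1 k) (theta_exp 3 1 l) => e f.
have [t [r [kE rb]]] : exists t r : int,
    k = 3 * t + r /\ (r = 0 \/ r = 1 \/ r = -1).
  by exists (divz (k + 1) 3), (modz (k + 1) 3 - 1); lia.
have [u [v [lE vb]]] : exists t r : int,
    l = 3 * t + r /\ (r = 0 \/ r = 1 \/ r = -1).
  by exists (divz (l + 1) 3), (modz (l + 1) 3 - 1); lia.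
rewrite kE lE => {kE lE}.
by case: rb => [|[|]] ->; case: vb => [|[|]] ->; lia.
Qed.

(** Gauss's [O f_4 = sum_k q^(k(2k+1))]: the triple product with [x = q^3],
    [y = q], as the numbers [4i + 1] and [4i + 3] are the odd numbers. *)
Lemma psi_eqmodX {F : fieldType} n :
  eqmodX n.+1
    (qpoch 'X^4 n * \prod_(i < n.*2) (1 + 'X^(i.*2.+1)))
    (\sum_(j < n.*2.+1) 'X^(theta_exp 3 1 (j%:Z - n%:Z)) : {poly F}).
Proof.
have odd_prod k : \prod_(i < k.*2) (1 + 'X^(i.*2.+1)) =
    \prod_(i < k) ((1 + 1 *: 'X^(3 + (3 + 1) * i)) *
                   (1 + 1 *: 'X^(1 + (3 + 1) * i))) :> {poly F}.
  elim: k => [|k IH]; first by rewrite !big_ord0.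
  rewrite doubleS !big_ord_recr -IH /= !scale1r -mulrA [in RHS](mulrC (1 + _)).
  by congr (_ * ((1 + 'X^_) * (1 + 'X^_))); lia.
have := @jacobi_triple_eqmodX F 1 3 1 n (mulr1 1) isT isT.
rewrite -odd_prod.
by under [X in eqmodX _ _ X]eq_bigr => j _ do rewrite expr1n scale1r.
Qed.

(** Euler's pentagonal number theorem in [q^12]: the triple product with
    [x = - q^24], [y = - q^12], whose three families of factors exhaust [f_12]. *)
Lemma pentagonal_eqmodX {F : fieldType} n :
  eqmodX n.+1 (qpoch 'X^12 (3 * n))
    (\sum_(j < n.*2.+1) (-1) ^+ `|j%:Z - n%:Z| *:
       'X^(theta_exp 24 12 (j%:Z - n%:Z)) : {poly F}).
Proof.
have trisect k : qpoch 'X^12 (3 * k) = qpoch 'X^(24 + 12) k *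
    \prod_(i < k) ((1 + -1 *: 'X^(24 + (24 + 12) * i)) *
                   (1 + -1 *: 'X^(12 + (24 + 12) * i))) :> {poly F}.
  elim: k => [|k IH]; first by rewrite /qpoch !big_ord0 mulr1.
  rewrite mulnS !addSn add0n !qpochS IH big_ord_recr /= !scaleN1r -!exprM.
  have -> : (12 * (3 * k).+1 = 12 + (24 + 12) * k)%N by lia.
  have -> : (12 * (3 * k).+2 = 24 + (24 + 12) * k)%N by lia.
  have -> : (12 * (3 * k).+3 = (24 + 12) * k.+1)%N by lia.
  by ring.
rewrite trisect; apply: jacobi_triple_eqmodX => //.
by rewrite mulrNN mulr1.
Qed.

(** * Reduction modulo 3 *)

Lemma qpoch_cube {F : fieldType} d n : 3 \in [pchar F] ->
  qpoch 'X^(3 * d) n = qpoch 'X^d n ^+ 3 :> {poly F}.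
Proof.
move=> F3; rewrite /qpoch -prodrXl; apply: eq_bigr => i _.
have three0 : 3%:R = 0 :> {poly F} by rewrite -polyC_natr (pcharf0 F3).
have -> : 'X^(3 * d) ^+ i.+1 = ('X^d ^+ i.+1) ^+ 3 :> {poly F}.
  by rewrite -!exprM; congr ('X^_); lia.
move: ('X^d ^+ i.+1) => x.
rewrite [RHS](_ : _ = 1 - x ^+ 3 + 3%:R * (x ^+ 2 - x)); last by ring.
by rewrite three0 mul0r addr0.
Qed.

(** [f_12 * O^2 / f_4 = f_4^2 O^2 = psi^2] in characteristic 3. *)
Lemma pentagonal_B_eqmodX {F : fieldType} n : 3 \in [pchar F] ->
  eqmodX n.+1
    ((\sum_(j < n.*2.+1) (-1) ^+ `|j%:Z - n%:Z| *:
       'X^(theta_exp 24 12 (j%:Z - n%:Z))) * \poly_(i < n.+1) (B i)%:R)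
    ((\sum_(j < n.*2.+1) 'X^(theta_exp 3 1 (j%:Z - n%:Z))) ^+ 2 : {poly F}).
Proof.
move=> F3; set pent := \sum_(j < _) _; set psi := \sum_(j < _) 'X^_.
set GB := \poly_(i < _) _.
pose P k : {poly F} := qpoch 'X^4 k.
have PP k : (n <= k)%N -> eqmodX n.+1 (P n) (P k).
  move=> nk; apply: eqmodX_sym.
  by apply: (eqmodX_leq _ _ _ _ _ (qpochXn_eqmodX 4 n k nk)); lia.
have P3 : eqmodX n.+1 pent (P n ^+ 3).
  apply: (@eqmodX_trans _ _ _ (P (3 * n)%N ^+ 3)).
    by rewrite -(qpoch_cube 4) //; apply/eqmodX_sym/pentagonal_eqmodX.
  by rewrite !exprS !expr0 !eqmodX_mul ?eqmodX_refl //;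
    apply/eqmodX_sym/PP; lia.
pose O : {poly F} := \prod_(i < n.*2) (1 + 'X^(i.*2.+1)).
have PB : eqmodX n.+1 (P n * GB) (O ^+ 2).
  have nn : (n <= n.*2)%N by lia.
  apply: eqmodX_trans (B_gf_eqmodX n.+1 n.*2 _); last by lia.
  by rewrite eqmodX_mul ?eqmodX_refl ?PP.
have PO : eqmodX n.+1 (P n * O) psi by apply: psi_eqmodX.
apply: eqmodX_trans (eqmodX_mul _ _ _ _ _ P3 (eqmodX_refl _ _)) _.
rewrite [X in eqmodX _ X](_ : _ = P n ^+ 2 * (P n * GB)); last by ring.
apply: eqmodX_trans (eqmodX_mul _ _ _ _ _ (eqmodX_refl _ _) PB) _.
by rewrite -exprMn !expr2 eqmodX_mul.
Qed.

(** * The congruence *)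

Lemma fsbig_int_centered {R : nmodType} n (f : int -> R) :
  (forall k, (n < `|k|)%N -> f k = 0) ->
  \sum_(k \in [set: int]) f k = \sum_(j < n.*2.+1) f (j%:Z - n%:Z).
Proof.
move=> f0; pose r := [seq j%:Z - n%:Z | j <- iota 0 n.*2.+1].
have ur : uniq r by rewrite map_inj_uniq ?iota_uniq // => i j; lia.
rewrite -(@fsbig_widen _ _ _ _ [set` r]).
- rewrite -fsbig_seq // big_map.
  by rewrite -(big_mkord xpredT (fun j => f (j%:Z - n%:Z))) /index_iota subn0.
- by [].
- move=> k [_ kr] /=; apply: f0; rewrite ltnNge; apply/negP => kn; apply: kr.
  by apply/mapP; exists (absz ((k : int) + n%:Z)); rewrite ?mem_iota; lia.
Qed.

Lemma coef_XnM_B {R : nzRingType} n (k : int) :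
  ('X^(theta_exp 24 12 k) * \poly_(i < n.+1) (B i)%:R : {poly R})`_n =
  (Bz (n%:Z - 6 * k * (3 * k + 1)))%:~R.
Proof.
have -> : 6 * k * (3 * k + 1) = (theta_exp 24 12 k)%:Z.
  by have := theta_expE 24 12 k; rewrite !expr2; lia.
rewrite coefXnM; case: ltnP => [lt|le].
  by have [m ->] : exists m, n%:Z - (theta_exp 24 12 k)%:Z = Negz m;
    first by exists (theta_exp 24 12 k - n).-1; lia.
by rewrite subzn // coef_poly ltnS leq_subr.
Qed.

Lemma exprN1z_absz (k : int) : (-1) ^ k = (-1) ^+ `|k| :> int.
Proof. by case: k => m; rewrite ?NegzE // -exprz_inv invrN1. Qed.

Theorem theorem1p3 (n j : nat) (hj : j = 1%N \/ j = 2%N) :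
  (\sum_(k \in [set: int])
     (-1) ^ k * Bz ((9 * n + 3 * j + 2)%N%:Z - 6 * k * (3 * k + 1))
   = 0 %[mod 3])%Z.
Proof.
set N := (9 * n + 3 * j + 2)%N.
have F3 : 3 \in [pchar 'F_3] by apply: pchar_Fp.
(* The argument of Bz is negative as soon as k exceeds N in absolute value. *)
rewrite (@fsbig_int_centered _ N); last first.
  move=> k Nk; suff : (N%:Z - 6 * k * (3 * k + 1) < 0)%R.
    by case: (_ - _)%R => // m _; rewrite mulr0.
  nia.
apply/eqP; rewrite eqz_mod_dvd subr0 (dvdz_pcharf F3) rmorph_sum /=.
have := eqmodX_coef _ _ _ N (ltnSn N) (@pentagonal_B_eqmodX 'F_3 N F3).
rewrite expr2 big_distrlr mulr_suml !coef_sum /= => E.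
move: E; rewrite [RHS]big1 => [E|i _].
  apply/eqP; rewrite -[RHS]E; apply: eq_bigr => i _.
  rewrite rmorphM /= -scalerAl coefZ coef_XnM_B.
  by rewrite exprN1z_absz rmorphXn /= rmorphN1.
rewrite coef_sum big1 // => l _.
rewrite -exprD coefXn eq_sym.
by rewrite (negPf (theta31_sum_neq n j _ _ hj)).
Qed.
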